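(* Let $\mathcal U,\mathcal Y$ be separable Hilbert spaces and let $\theta$ be a function holomorphic on some neighbourhood $\Gamma$ of $z=0$ in $\mathbb C^N$, with values in $[\mathcal U,\mathcal Y]$, having a zero of multiplicity $m=m(\theta)>0$ at $z=0$. Then there exist separable Hilbert spaces $\mathcal Y^{(0)}=\mathcal Y,\mathcal Y^{(1)},\dots,\mathcal Y^{(m)}$, operators $L^{(j)}_k\in[\mathcal Y^{(j)},\mathcal Y^{(j-1)}]$ ($j=1,\dots,m$; $k=1,\dots,N$), and a function $\phi$ holomorphic on some neighbourhood of $z=0$ with values in $[\mathcal U,\mathcal Y^{(m)}]$ and $\phi(0)\neq 0$, such that $$\theta(z)=z\mathbf L^{(1)}\,z\mathbf L^{(2)}\cdots z\mathbf L^{(m)}\,\phi(z)$$ holds on some neighbourhood (possibly smaller than $\Gamma$) of $z=0$.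
   Context: $[\mathcal U,\mathcal Y]$ denotes the Banach space of bounded linear operators from $\mathcal U$ to $\mathcal Y$. For an $N$-tuple $\mathbf T=(T_1,\dots,T_N)$ of operators and $z=(z_1,\dots,z_N)\in\mathbb C^N$, $z\mathbf T:=\sum_{k=1}^N z_kT_k$. A function $\theta$ holomorphic near $z=0$, not vanishing identically near $0$, has a zero of multiplicity $m$ at $z=0$ if, in its expansion $\theta(z)=\sum_{n\ge0}\theta_n(z)$ into homogeneous polynomials $\theta_n$ of degree $n$, one has $\theta_n\equiv0$ for $n<m$ and $\theta_m\not\equiv 0$. *)

(* Defs.v *)
From HB Require Import structures.
From mathcomp Require Import all_boot all_order all_algebra.
From mathcomp Require Import all_classical all_reals all_analysis.
From mathcomp Require Import complex.
Set Implicit Arguments. Unset Strict Implicit. Unset Printing Implicit Defensive.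
Import Order.TTheory GRing.Theory Num.Theory.
Import numFieldNormedType.Exports.
Local Open Scope classical_set_scope.
Local Open Scope ring_scope.

(* Scalars: the complex numbers C = R[i] over a real type R.
   Banach spaces over C are the library's [completeNormedModType R[i]];
   the variable space C^N is ['rV[R[i]]_N] (max-norm, equivalent to any norm). *)

Definition Cx (R : realType) : numClosedFieldType := R[i].

Section Defs.
Variable R : realType.
Local Notation C := (Cx R).

(* An inner product on H, linear in the first argument, inducing the norm of H. *)
Definition is_inner_product (H : normedModType C) (ip : H -> H -> C) : Prop :=
  [/\ (forall (a : C) (x y z : H), ip (a *: x + y) z = a * ip x z + ip y z),
      (forall x y : H, ip y x = (ip x y)^*) &
      (forall x : H, ip x x = `|x| ^+ 2)].

(* H is a separable Hilbert space: a complete normed C-space whose norm comes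
   from an inner product, having a countable dense subset. *)
Definition separable_hilbert (H : completeNormedModType C) : Prop :=
  (exists ip : H -> H -> C, is_inner_product ip) /\
  (exists u : nat -> H, dense (range u)).

(* T belongs to [A, B]: bounded (= continuous) C-linear operator. *)
Definition bounded_op (A B : normedModType C) (T : A -> B) : Prop :=
  (forall (a : C) (x y : A), T (a *: x + y) = a *: T x + T y) /\ continuous T.

(* z T := sum_k z_k T_k *)
Definition zop (N : nat) (A B : normedModType C) (z : 'rV[C]_N)
  (T : 'I_N -> A -> B) : A -> B :=
  fun x => \sum_(k < N) z ord0 k *: T k x.

(* f : C^N -> [A,B] is holomorphic on the open set G: at every point z0 of G it is
   Frechet complex-differentiable in operator norm, i.e. there are D_k in [A,B] with
   || f z - f z0 - (z - z0) D || = o(|z - z0|)  (operator norm written out). *)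
Definition holomorphic_on (N : nat) (A B : normedModType C)
  (G : set 'rV[C]_N) (f : 'rV[C]_N -> A -> B) : Prop :=
  open G /\
  (forall z, G z -> bounded_op (f z)) /\
  forall z0, G z0 ->
    exists D : 'I_N -> A -> B, (forall k, bounded_op (D k)) /\
      forall eps : C, 0 < eps -> exists2 delta : C, 0 < delta &
        forall z, `|z - z0| < delta -> forall x : A,
          `|f z x - f z0 x - zop (z - z0) D x| <= eps * `|z - z0| * `|x|.

(* P : C^N -> [A,B] is a homogeneous polynomial of degree n:
   P(z) = sum over index words s in {1..N}^n of z_{s_1} ... z_{s_n} c_s,
   with coefficients c_s in [A,B]. *)
Definition homogeneous_poly (N n : nat) (A B : normedModType C)
  (P : 'rV[C]_N -> A -> B) : Prop :=
  exists c : n.-tuple 'I_N -> A -> B, (forall s, bounded_op (c s)) /\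
    forall z x, P z x = \sum_(s : n.-tuple 'I_N) (\prod_(i <- s) z ord0 i) *: c s x.

(* f has a zero of multiplicity m at 0: on a neighbourhood of 0,
   f(z) = sum_n f_n(z) with f_n homogeneous of degree n (series converging in
   operator norm), f_n = 0 for n < m and f_m not identically 0. *)
Definition zero_multiplicity (N : nat) (A B : normedModType C)
  (f : 'rV[C]_N -> A -> B) (m : nat) : Prop :=
  exists (V : set 'rV[C]_N) (P : nat -> 'rV[C]_N -> A -> B),
    [/\ open V /\ V 0,
      (forall n, homogeneous_poly n (P n)),
      (forall z, V z -> forall eps : C, 0 < eps -> exists M, forall n, (M <= n)%N ->
          forall x : A, `|f z x - \sum_(k < n) P k z x| <= eps * `|x|),
      (forall n, (n < m)%N -> forall z x, P n z x = 0) &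
      (exists z x, P m z x != 0)].

(* The chain of spaces Y^(0) = Y, Y^(j+1) = Ys j. *)
Definition chainT (Y : completeNormedModType C) (Ys : nat -> completeNormedModType C)
  (j : nat) : completeNormedModType C :=
  match j with 0 => Y | j'.+1 => Ys j' end.

(* chainprod z L j = z L^(1) z L^(2) ... z L^(j) : Y^(j) -> Y,
   where L j' : 'I_N -> Y^(j'+1) -> Y^(j') encodes L^(j'+1). *)
Fixpoint chainprod (N : nat) (Y : completeNormedModType C)
  (Ys : nat -> completeNormedModType C) (z : 'rV[C]_N)
  (L : forall j : nat, 'I_N -> chainT Y Ys j.+1 -> chainT Y Ys j)
  (j : nat) : chainT Y Ys j -> Y :=
  match j return chainT Y Ys j -> Y with
  | 0 => fun y => y
  | j'.+1 => fun y => @chainprod N Y Ys z L j' (zop z (L j') y)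
  end.

End Defs.
Arguments chainprod {R N Y Ys} z L j _.

(* Main.v *)
Require Import Defs.
From HB Require Import structures.
From mathcomp Require Import all_boot all_order all_algebra.
From mathcomp Require Import all_classical all_reals all_analysis.
From mathcomp Require Import complex.
From mathcomp Require Import cyclic separable cyclotomic ring.
Import Order.TTheory GRing.Theory Num.Theory.
Import numFieldNormedType.Exports.
Local Open Scope classical_set_scope.
Local Open Scope ring_scope.

Set Implicit Arguments.
Unset Strict Implicit.
Unset Printing Implicit Defensive.

(** Let [P_n] be the homogeneous parts of [theta].  Since [theta] is bounded near
    [0], averaging over roots of unity (a discrete Cauchy formula, no integration)
    bounds every [P_n] uniformly on a small ball, and a second average over tuples
    of roots of unity bounds its monomial coefficients.  So [theta] is the sum of a
    geometrically dominated series [sum_t z_t d_t] over words [t], in which [d_t]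
    vanishes for [|t| < m] and not for all [|t| = m].  As [d_nil = 0], peeling off
    the first letter gives [theta(z) = sum_k z_k theta_k(z)] with
    [theta_k(z) = sum_t z_t d_(k t)]: that is [z L] applied to the column
    [(theta_k)_k] with values in the Hilbert power of [Y], where [L_k] is the
    [k]-th coordinate.  After [m] steps the constant term is the column of all
    [d_t] with [|t| = m], which is nonzero. *)

(** * Common radii and open balls *)

Lemma le_pair_gt0 (K : numFieldType) (a b : K) : 0 < a -> 0 < b ->
  exists2 c, 0 < c & c <= a /\ c <= b.
Proof.
move=> a0 b0; have ab0 : 0 < a + b by rewrite addr_gt0.
(* This witness lies below both numbers without any case distinction on which is smaller. *)
exists (a * b / (a + b)); first by rewrite divr_gt0 ?mulr_gt0.
rewrite !ler_pdivrMr// [b * _]mulrC ler_pM2l// ler_pM2r//.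
by rewrite lerDl lerDr !ltW.
Qed.

Lemma open_norm_lt (K : numFieldType) (V : normedModType K) (r : K) :
  open [set z : V | `|z| < r].
Proof.
rewrite openE => z /= zr; apply/nbhs_normP; exists (r - `|z|).
  by rewrite /= subr_gt0.
move=> y /=; rewrite ltrBrDr => /(le_lt_trans _); apply.
by rewrite distrC -[X in `|X| <= _](subrK z) ler_normD.
Qed.

Lemma open_norm_ball (K : numFieldType) (V : normedModType K) (G : set V) :
  open G -> G 0 -> exists2 r : K, 0 < r & forall z, `|z| < r -> G z.
Proof.
move=> oG G0; have /nbhs_norm0P[r /= r0 rG] : nbhs 0 G by exact: open_nbhs_nbhs.
by exists r.
Qed.

(** * Bounded operators *)

Section BoundedOperators.
Variables (R : realType) (A B : normedModType (Cx R)).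
Implicit Type T : A -> B.

Lemma bounded_op_of_bound T (M : Cx R) :
  (forall (a : Cx R) x y, T (a *: x + y) = a *: T x + T y) ->
  (forall x, `|T x| <= M * `|x|) -> bounded_op T.
Proof.
move=> Tl TM; split => // x; apply/cvgrPdist_le => e e0.
(* [M] may be zero or, when [A] is trivial, any complex number; [|M| + 1] is positive and can be
   divided by. *)
have M0 : 0 < `|M| + 1 by rewrite ltr_wpDl.
near=> y.
have -> : T x - T y = T (x - y) by rewrite addrC -scaleN1r -Tl scaleN1r addrC.
rewrite (le_trans (TM _))//; apply: (@le_trans _ _ ((`|M| + 1) * `|x - y|)).
  have : 0 <= M * `|x - y| by rewrite (le_trans _ (TM _)).
  move=> /ger0_norm <-; rewrite normrM normr_id ler_wpM2r// lerDl.
  exact: ler01.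
rewrite -ler_pdivlMl// mulrC; near: y; apply: cvgr_dist_le => //.
by rewrite divr_gt0.
Unshelve. all: by end_near. Qed.

Lemma bounded_op_bound T : bounded_op T ->
  exists2 M, 0 < M & forall x, `|T x| <= M * `|x|.
Proof.
move=> [Tl Tc].
pose lT := GRing.isLinear.Build _ _ _ _ T Tl.
pose f : {linear A -> B} := HB.pack T lT.
by have /linear_bounded_continuous/linear_boundedP/pinfty_ex_gt0[M M0 ?] :
  continuous f by []; exists M.
Qed.

Lemma bounded_op0 T : bounded_op T -> T 0 = 0.
Proof.
move=> [Tl _]; have := Tl 1 0 0; rewrite !scale1r addr0.
by move=> /eqP; rewrite -subr_eq subrr => /eqP.
Qed.

End BoundedOperators.

(** * Finite Hilbert powers: Euclidean norm and completeness *)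

Section HilbertPower.
Variables (K : numClosedFieldType) (n : nat).

(** An alias, so that the Euclidean norm can be attached to it; a max norm would in general not come
    from an inner product. *)
Definition l2pow (Y : Type) : Type := {ffun 'I_n -> Y}.

HB.instance Definition _ (Y : normedModType K) :=
  GRing.Lmodule.copy (l2pow Y) {ffun 'I_n -> Y}.

Section Normed.
Variable Y : normedModType K.
Implicit Types x y : l2pow Y.

Definition l2norm x : K := sqrtC (\sum_i `|x i| ^+ 2).

Lemma sqr_l2norm x : l2norm x ^+ 2 = \sum_i `|x i| ^+ 2.
Proof. by rewrite sqrtCK. Qed.

Lemma l2norm_ge0 x : 0 <= l2norm x.
Proof. by rewrite sqrtC_ge0 sumr_ge0// => i _; rewrite exprn_ge0. Qed.

Lemma coord_le_l2norm x i : `|x i| <= l2norm x.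
Proof.
rewrite -ler_sqr ?nnegrE ?l2norm_ge0// sqr_l2norm (bigD1 i)//= lerDl.
by rewrite sumr_ge0// => j _; rewrite exprn_ge0.
Qed.

(** Each square is at most the coordinate times the whole sum. With [coord_le_l2norm] this reduces
    convergence and density to single coordinates. *)
Lemma l2norm_le_sum x : l2norm x <= \sum_i `|x i|.
Proof.
have s0 : 0 <= \sum_i `|x i| by rewrite sumr_ge0.
rewrite -ler_sqr ?nnegrE ?l2norm_ge0// sqr_l2norm expr2 mulr_suml.
apply: ler_sum => i _; rewrite expr2 ler_wpM2l// (bigD1 i)//= lerDl.
by rewrite sumr_ge0.
Qed.

Lemma l2norm0_eq0 x : l2norm x = 0 -> x = 0.
Proof.
move=> x0; apply/ffunP => i; rewrite ffunE; apply/eqP; rewrite -normr_eq0.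
by rewrite eq_le normr_ge0 andbT -x0 coord_le_l2norm.
Qed.

Lemma l2normZ (a : K) x : l2norm (a *: x) = `|a| * l2norm x.
Proof.
apply/eqP; rewrite -(eqrXn2 (n := 2))//; last 2 first.
- exact: l2norm_ge0.
- by rewrite mulr_ge0// l2norm_ge0.
rewrite exprMn !sqr_l2norm mulr_sumr; apply/eqP/eq_bigr => i _.
by rewrite ffunE normrZ exprMn.
Qed.

(* For A, B > 0, (A + B)(B a^2 + A b^2) - A B (a + b)^2 = (B a - A b)^2; summing
   over coordinates with A, B the norms gives Minkowski's inequality. *)
Lemma ler_l2normD x y : l2norm (x + y) <= l2norm x + l2norm y.
Proof.
have [/l2norm0_eq0->|x0] := eqVneq (l2norm x) 0.
  by rewrite add0r lerDr l2norm_ge0.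
have [/l2norm0_eq0->|y0] := eqVneq (l2norm y) 0.
  by rewrite addr0 lerDl l2norm_ge0.
have {}x0 : 0 < l2norm x by rewrite lt_def x0 l2norm_ge0.
have {}y0 : 0 < l2norm y by rewrite lt_def y0 l2norm_ge0.
rewrite -ler_sqr ?nnegrE ?addr_ge0 ?l2norm_ge0//.
rewrite -(ler_pM2l (mulr_gt0 x0 y0)).
set A := l2norm x in x0 *; set B := l2norm y in y0 *.
have -> : A * B * (A + B) ^+ 2 =
    \sum_i (A + B) * (B * `|x i| ^+ 2 + A * `|y i| ^+ 2).
  rewrite -mulr_sumr big_split/= -!mulr_sumr -!sqr_l2norm -/A -/B; ring.
rewrite sqr_l2norm mulr_sumr; apply: ler_sum => i _; rewrite ffunE.
apply: (@le_trans _ _ (A * B * (`|x i| + `|y i|) ^+ 2)).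
  apply: ler_wpM2l; first by rewrite mulr_ge0 ?ltW.
  by rewrite lerXn2r ?nnegrE ?addr_ge0// ler_normD.
rewrite -subr_ge0.
have -> : (A + B) * (B * `|x i| ^+ 2 + A * `|y i| ^+ 2) -
  A * B * (`|x i| + `|y i|) ^+ 2 = (B * `|x i| - A * `|y i|) ^+ 2 by ring.
by rewrite real_exprn_even_ge0// realB// realM// ?normr_real// gtr0_real.
Qed.

HB.instance Definition _ :=
  Lmodule_isNormed.Build K (l2pow Y) ler_l2normD l2normZ l2norm0_eq0.

Lemma l2pow_norm x : `|x| = l2norm x. Proof. by []. Qed.

End Normed.

Lemma l2pow_complete (Y : completeNormedModType K) (F : set_system (l2pow Y)) :
  ProperFilter F -> cauchy F -> cvg F.
Proof.
move=> FF /cauchy_ballP Fc.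
have cF (i : 'I_n) : cvg ((fun x : l2pow Y => x i) @ F).
  apply/cauchy_cvgP/cauchy_ballP => e e0.
  have [/= [A B] /= [FA FB] AB] := Fc e e0.
  exists ([set x i | x in A], [set x i | x in B]) => /=.
    by split; [apply: filterS FA|apply: filterS FB] => x ?; exists x.
  move=> [_ _] [/= [x Ax <-] [y By <-]].
  have /= := AB (x, y) (conj Ax By).
  rewrite -!ball_normE/= => /(le_lt_trans _); apply.
  by rewrite l2pow_norm; have := coord_le_l2norm (x - y) i; rewrite !ffunE.
apply/cvg_ex; exists ([ffun i => lim ((fun x : l2pow Y => x i) @ F)] : l2pow Y).
apply/cvgrPdist_le => e e0.
(* Each of the [n] coordinates gets a share of [e]; [n.+1] keeps the divisor nonzero when [n] is
   0. *)
have e'0 : 0 < e / n.+1%:R by rewrite divr_gt0.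
have : \forall x \near F, forall i, `|lim ((fun x : l2pow Y => x i) @ F) -
    (x : l2pow Y) i| <= e / n.+1%:R.
  apply: filter_forall => i; have /cvgrPdist_le := cF i; exact.
apply: filterS => x Hx.
rewrite l2pow_norm (le_trans (l2norm_le_sum _))//.
apply: (@le_trans _ _ (\sum_(i < n) e / n.+1%:R)).
  by apply: ler_sum => i _; rewrite !ffunE.
rewrite sumr_const card_ord -[leLHS]mulr_natr mulrAC ler_pdivrMr// ler_wpM2l ?ltW//.
by rewrite ltr_nat.
Qed.

HB.instance Definition _ (Y : completeNormedModType K) :=
  Uniform_isComplete.Build (l2pow Y) (@l2pow_complete Y).

End HilbertPower.

(** * Hilbert powers inherit inner product and separability *)

Section SeparableHilbertPower.
Variables (R : realType) (n : nat) (Y : completeNormedModType (Cx R)).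

Lemma coord_bounded_op (k : 'I_n) :
  bounded_op (fun y : l2pow n Y => y k).
Proof.
apply: (@bounded_op_of_bound _ _ _ _ 1) => [a x y|x]; first by rewrite !ffunE.
by rewrite mul1r l2pow_norm coord_le_l2norm.
Qed.

(** Inner products add over coordinates. The dense sequence runs through all tuples of terms of [u],
    enumerated by the countability of [{ffun 'I_n -> nat}]. *)
Lemma l2pow_separable_hilbert :
  separable_hilbert Y -> separable_hilbert (l2pow n Y).
Proof.
move=> [[ip [ipl ipC ipn]] [u ud]]; split.
  exists (fun x y : l2pow n Y => \sum_i ip (x i) (y i)); split.
  - move=> a x y z; rewrite mulr_sumr -big_split/=; apply: eq_bigr => i _.
    by rewrite !ffunE ipl.
  - by move=> x y; rewrite rmorph_sum/=; apply: eq_bigr => i _; rewrite ipC.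
  - move=> x; rewrite l2pow_norm sqr_l2norm; apply: eq_bigr => i _; exact: ipn.
(* Numbers that code no tuple get the zero tuple, which only repeats a term of the sequence. *)
pose idx k : {ffun 'I_n -> nat} := odflt [ffun=> 0%N] (unpickle k).
exists (fun k => [ffun i => u (idx k i)] : l2pow n Y) => A [x Ax] oA.
have /nbhs_normP[e /= e0 eA] : nbhs x A by exact: open_nbhs_nbhs.
have e'0 : 0 < e / n.+1%:R by rewrite divr_gt0.
have /choice[f fP] : forall i, exists k, `|x i - u k| < e / n.+1%:R.
  move=> i; have [||y [/= By [k _ uk]]] := ud (ball (x i) (e / n.+1%:R)).
  - by exists (x i); exact: ballxx.
  - exact: ball_open.
  - by exists k; rewrite uk; move: By; rewrite -ball_normE.
pose g : {ffun 'I_n -> nat} := [ffun i => f i].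
exists ([ffun i => u (g i)] : l2pow n Y); split; last first.
  by exists (pickle g) => //=; apply/ffunP => i; rewrite !ffunE /idx pickleK/= ffunE.
apply: eA => /=; rewrite l2pow_norm (le_lt_trans (l2norm_le_sum _))//.
apply: (@le_lt_trans _ _ (\sum_(i < n) e / n.+1%:R)).
  by apply: ler_sum => i _; rewrite !ffunE ltW.
rewrite sumr_const card_ord -[ltLHS]mulr_natr mulrAC ltr_pdivrMr// ltr_pM2l//.
by rewrite ltr_nat.
Qed.

End SeparableHilbertPower.

(** * Geometrically dominated series *)

Section GeometricSeries.
Variable R : realType.

Lemma geometric_small (M e : Cx R) : 0 <= M -> 0 < e -> exists n, M / 2 ^+ n < e.
Proof.
move=> M0 e0; have Me0 : 0 <= M / e by rewrite divr_ge0// ltW.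
have [n Mn] : exists n, M / e < n%:R.
  (* A nonnegative complex number equals its real part, so the Archimedean property of [R]
     applies. *)
  have re := RRe_real (ger0_real Me0); rewrite -re lecR in Me0.
  exists (Num.Def.archi_bound (complex.Re (M / e))); rewrite -re.
  rewrite -(rmorph_nat (real_complex R)) ltcR; exact: archi_boundP.
exists n; rewrite ltr_pdivrMr ?exprn_gt0// mulrC -ltr_pdivrMr//.
by rewrite (lt_le_trans Mn)// -natrX ler_nat ltnW// ltn_expl.
Qed.

Definition seqsum (B : completeNormedModType (Cx R)) (a : nat -> B) : B :=
  limn (series a).

Section OneSpace.
Variable B : completeNormedModType (Cx R).
Implicit Types (a b : nat -> B) (M : Cx R).

(** The ratio 1/2 is fixed once and for all: on a small enough ball every series below decays at
    this rate. *)
Definition geometric_bound a M := forall n, `|a n| <= M / 2 ^+ n.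

Lemma geometric_bound_ge0 a M : geometric_bound a M -> 0 <= M.
Proof. by move=> /(_ 0%N); rewrite expr0 divr1; exact: le_trans. Qed.

Lemma geometric_tail a M m n : geometric_bound a M ->
  `|\sum_(m <= k < n) a k| <= M * 2 / 2 ^+ m.
Proof.
move=> aM; have M0 := geometric_bound_ge0 aM.
have [mn|/ltnW nm] := leqP m n; last first.
  by rewrite big_geq// normr0 divr_ge0 ?mulr_ge0 ?exprn_ge0.
(* The subtracted term makes the induction on [n] close: the bound grows at step [n] by exactly
   [M / 2 ^+ n]. *)
suff : `|\sum_(m <= k < n) a k| <= M * 2 / 2 ^+ m - M * 2 / 2 ^+ n.
  by move/le_trans; apply; rewrite gerBl divr_ge0 ?mulr_ge0 ?exprn_ge0.
elim: n mn => [|n IH].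
  by rewrite leqn0 => /eqP ->; rewrite big_geq// normr0 subrr.
rewrite leq_eqVlt => /predU1P[->|]; first by rewrite big_geq// normr0 subrr.
rewrite ltnS => mn; rewrite big_nat_recr//= (le_trans (ler_normD _ _))//.
apply: le_trans (lerD (IH mn) (aM n)) _; rewrite le_eqVlt; apply/orP; left.
have p0 k : 2 ^+ k != 0 :> Cx R by rewrite expf_neq0.
by apply/eqP; rewrite exprS; field; rewrite !p0/=.
Qed.

Lemma geometric_cvg a M : geometric_bound a M -> series a @ \oo --> seqsum a.
Proof.
move=> aM; apply/cauchy_cvgP/cauchy_seriesP => e e0.
have M20 : 0 <= M * 2 by rewrite mulr_ge0// (geometric_bound_ge0 aM).
have [m mP] := geometric_small M20 e0.
exists ([set n | (m <= n)%N], setT).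
  by split; [exact: nbhs_infty_ge|exact: filterT].
move=> [i j] /= [mi _]; rewrite (le_lt_trans (geometric_tail _ _ aM))//.
rewrite (le_lt_trans _ mP)// ler_wpM2l// lef_pV2 ?posrE ?exprn_gt0//.
by rewrite ler_eXn2l// ltr1n.
Qed.

Lemma seqsum_unique a (l : B) :
  (forall e : Cx R, 0 < e -> exists m, forall n, (m <= n)%N ->
     `|l - \sum_(k < n) a k| <= e) -> seqsum a = l.
Proof.
move=> al; apply/cvg_lim => //; apply/cvgrPdist_le => e /al[m mP].
by exists m => // n /= /mP; rewrite /series/= big_mkord.
Qed.

Lemma seqsum_tail a M m : geometric_bound a M ->
  `|seqsum a - \sum_(k < m) a k| <= M * 2 / 2 ^+ m.
Proof.
move=> aM; apply/ler_addgt0Pl => e e0.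
have /cvgrPdist_le/(_ e e0)[n _ /(_ (maxn n m) (leq_maxl n m))] :=
  geometric_cvg aM.
rewrite /series/= (@big_cat_nat _ _ _ m) ?leq_maxr//= big_mkord.
move=> /lerD/(_ (geometric_tail m (maxn n m) aM)); apply: le_trans.
by rewrite (le_trans _ (ler_normD _ _))// opprD addrA subrK.
Qed.

Lemma seqsum_le a M : geometric_bound a M -> `|seqsum a| <= M * 2.
Proof. by move/(seqsum_tail 0); rewrite big_ord0 subr0 expr0 divr1. Qed.

Lemma seqsum_linear (c : Cx R) a b M M' :
  geometric_bound a M -> geometric_bound b M' ->
  seqsum (fun n => c *: a n + b n) = c *: seqsum a + seqsum b.
Proof.
move=> /geometric_cvg ca /geometric_cvg cb; apply/cvg_lim => //.
rewrite (_ : series _ = (c \*: series a) \+ series b); last first.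
  by apply/funext => n; rewrite /series/= scaler_sumr big_split.
by apply: cvgD => //; exact: cvgZr.
Qed.

Lemma seqsum_head a : (forall n, a n.+1 = 0) -> seqsum a = a 0%N.
Proof.
move=> aS; apply: seqsum_unique => e e0; exists 1%N => -[//|n] _.
rewrite big_ord_recl/= big1 ?addr0 ?subrr ?normr0 ?ltW//.
Qed.

Lemma geometric_boundB a b M M' :
  geometric_bound a M -> geometric_bound b M' ->
  geometric_bound (fun n => a n - b n) (M + M').
Proof.
move=> aM bM n; rewrite mulrDl (le_trans (ler_normB _ _))//.
exact: lerD.
Qed.

Lemma seqsumB a b M M' : geometric_bound a M -> geometric_bound b M' ->
  seqsum (fun n => a n - b n) = seqsum a - seqsum b.
Proof.
move=> aM bM; rewrite addrC -scaleN1r -(seqsum_linear _ bM aM).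
by congr seqsum; apply/funext => n; rewrite scaleN1r addrC.
Qed.

(** The bound [M'] is returned along with the identity because both the induction and later uses of
    [seqsumB] need the combined series to be dominated. *)
Lemma seqsum_sum (I : finType) (c : I -> Cx R) (a : I -> nat -> B) M :
  (forall i, geometric_bound (a i) M) ->
  exists2 M', geometric_bound (fun n => \sum_i c i *: a i n) M' &
    seqsum (fun n => \sum_i c i *: a i n) = \sum_i c i *: seqsum (a i).
Proof.
move=> aM; elim: (index_enum I) => [|i s [M' sM sE]].
  exists 0 => [n|]; first by rewrite big_nil normr0 mul0r.
  by rewrite seqsum_head => [|n]; rewrite !big_nil.
exists (`|c i| * M + M') => [n|].
  rewrite big_cons (le_trans (ler_normD _ _))// mulrDl lerD//.
  by rewrite normrZ -mulrA ler_wpM2l//; exact: aM.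
rewrite big_cons -sE -(seqsum_linear _ (aM i) sM); congr seqsum.
by apply/funext => n; rewrite big_cons.
Qed.

Lemma seqsumS a M : geometric_bound a M -> a 0%N = 0 ->
  seqsum a = seqsum (fun n => a n.+1).
Proof.
move=> /geometric_cvg ca a0; apply/esym/cvg_lim => //.
rewrite (_ : series _ = fun n => series a n.+1); first by rewrite cvg_shiftS.
by apply/funext => n; rewrite /series/= big_nat_recl// a0 add0r.
Qed.

End OneSpace.

Lemma seqsum_op (A B : completeNormedModType (Cx R)) (T : A -> B) a M :
  bounded_op T -> geometric_bound a M ->
  seqsum (fun n => T (a n)) = T (seqsum a).
Proof.
move=> bT /geometric_cvg ca; apply/cvg_lim => //.
rewrite (_ : series _ = T \o series a); last first.
  apply/funext => n; rewrite /series/=.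
  elim: n => [|n IH]; first by rewrite !big_geq// (bounded_op0 bT).
  rewrite !big_nat_recr//= IH.
  by rewrite -[X in T (X + _)]scale1r bT.1 scale1r.
by apply: continuous_cvg => //; exact: bT.2.
Qed.

End GeometricSeries.

(** * Noncommutative monomials: size, derivative and Taylor remainder *)

Section WordSeries.
Variables (R : realType) (N : nat).
Local Notation C := (Cx R).
Implicit Types (z h : 'rV[C]_N).

Lemma mx_coord_le z k : `|z ord0 k| <= `|z|.
Proof.
rewrite [leRHS]/Num.norm/= mx_normE.
rewrite [leLHS](_ : _ = `|z ord0 k|%:nng%:num)// [_ <= _%:num]num_le.
exact: (le_bigmax _ (fun i => `|z i.1 i.2|%:nng) (ord0, k)).
Qed.

Lemma mx_norm_le z (r : C) : 0 <= r -> (forall k, `|z ord0 k| <= r) -> `|z| <= r.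
Proof.
move=> r0 zr; have [/eqP|z0] := eqVneq `|z| 0; first by move/eqP ->.
by have [[i k] zE] := mx_norm_neq0 z0; rewrite [leLHS]zE /= (ord1 i).
Qed.

Section Terms.
Variables (A B : normedModType C).
Implicit Types (d : seq 'I_N -> A -> B) (x : A).

(* wterm is the Horner form of the sum over words t of length n of z_t d_t x;
   dwterm is its partial derivative with respect to z_j. *)
Fixpoint wterm n d z x : B :=
  if n is n'.+1 then \sum_k z ord0 k *: wterm n' (fun t => d (k :: t)) z x
  else d [::] x.

Fixpoint dwterm n d z j x : B :=
  if n is n'.+1 then wterm n' (fun t => d (j :: t)) z x +
    \sum_k z ord0 k *: dwterm n' (fun t => d (k :: t)) z j x
  else 0.

(** Links the Horner recursion to the sums in [homogeneous_poly]; a nonempty word corresponds to its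
    head letter and its tail. *)
Lemma wterm_tuple n d z x :
  wterm n d z x = \sum_(t : n.-tuple 'I_N) (\prod_(i <- t) z ord0 i) *: d t x.
Proof.
elim: n d => [|n IH] d /=.
  rewrite (big_pred1 [tuple]) /=; last by move=> t; rewrite (tuple0 t) /= eqxx.
  by rewrite big_nil scale1r.
under eq_bigr do rewrite IH scaler_sumr.
rewrite pair_big/= (reindex (fun t : n.+1.-tuple 'I_N =>
  (thead t, [tuple of behead t]))) /=; last first.
  exists (fun p : 'I_N * n.-tuple 'I_N => [tuple of p.1 :: p.2]) => [t _|[k t] _] /=.
    by rewrite -tuple_eta.
  by rewrite theadE; congr (_, _); exact: val_inj.
apply: eq_bigr => t _; case/tupleP: t => k t /=.
by rewrite theadE big_cons scalerA.
Qed.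

Lemma wterm_linear n d z (a : C) x y : (forall t, bounded_op (d t)) ->
  wterm n d z (a *: x + y) = a *: wterm n d z x + wterm n d z y.
Proof.
elim: n d => [|n IH] d dl /=; first exact: (dl [::]).1.
rewrite scaler_sumr -big_split/=; apply: eq_bigr => k _.
by rewrite IH// scalerDr !scalerA mulrC.
Qed.

Lemma dwterm_linear n d z j (a : C) x y : (forall t, bounded_op (d t)) ->
  dwterm n d z j (a *: x + y) = a *: dwterm n d z j x + dwterm n d z j y.
Proof.
elim: n d => [|n IH] d dl /=; first by rewrite scaler0 addr0.
rewrite wterm_linear// scalerDr addrACA; congr (_ + _).
rewrite scaler_sumr -big_split/=; apply: eq_bigr => k _.
by rewrite IH// scalerDr !scalerA mulrC.
Qed.

Lemma wterm0 n d x : wterm n.+1 d 0 x = 0.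
Proof. by rewrite /= big1// => k _; rewrite mxE scale0r. Qed.

Lemma norm_zsum_le z (v : 'I_N -> B) (r V : C) : 0 <= V ->
  (forall k, `|z ord0 k| <= r) -> (forall k, `|v k| <= V) ->
  `|\sum_k z ord0 k *: v k| <= N%:R * (r * V).
Proof.
move=> V0 zr vV; rewrite (le_trans (ler_norm_sum _ _ _))//.
apply: (@le_trans _ _ (\sum_(k < N) r * V)); last first.
  by rewrite sumr_const card_ord mulr_natl.
by apply: ler_sum => k _; rewrite normrZ ler_pM.
Qed.

Section Bounds.
Variables (q r : C).
Hypotheses (q0 : 0 <= q) (qr : N%:R * (r * q) <= 4^-1).

(** The vector [x] is fixed here so that [M] can absorb its norm. *)
Definition word_bound d x (M : C) := forall t, `|d t x| <= M * q ^+ size t.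

Lemma word_boundS d x M k :
  word_bound d x M -> word_bound (fun t => d (k :: t)) x (q * M).
Proof. by move=> dM t; have := dM (k :: t); rewrite /= exprS mulrCA mulrA. Qed.

Lemma word_bound_ge0 d x M : word_bound d x M -> 0 <= M.
Proof. by move=> /(_ [::]); rewrite expr0 mulr1; exact: le_trans. Qed.

(** Each further letter costs [N r q], at most 1/4 by [qr]. A quarter instead of a half leaves room
    for the extra summand in the recursions below, which still decay like [2 ^- n]. *)
Lemma norm_zsum_quarter z (v : 'I_N -> B) (V : C) : 0 <= V ->
  (forall k, `|z ord0 k| <= r) -> (forall k, `|v k| <= q * V) ->
  `|\sum_k z ord0 k *: v k| <= V / 4.
Proof.
move=> V0 zr vV.
apply: le_trans (norm_zsum_le (mulr_ge0 q0 V0) zr vV) _.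
by rewrite mulrA mulrA -[N%:R * r * q]mulrA mulrC ler_wpM2l.
Qed.

Lemma wterm_le n d z x M : (forall k, `|z ord0 k| <= r) -> word_bound d x M ->
  `|wterm n d z x| <= M / 2 ^+ n.
Proof.
move=> zr; elim: n d M => [|n IH] d M dM /=.
  by have := dM [::]; rewrite !expr0 divr1 mulr1.
have M0 := word_bound_ge0 dM.
apply: (@le_trans _ _ (M / 2 ^+ n / 4)).
  apply: norm_zsum_quarter => // [|k]; first by rewrite divr_ge0 ?exprn_ge0.
  by rewrite mulrA; apply: IH; exact: word_boundS.
rewrite exprSr invfM mulrA ler_wpM2l ?divr_ge0 ?exprn_ge0//.
by rewrite lef_pV2 ?posrE// ler_nat.
Qed.

(** The factor 4 closes the recursion: [q M / 2^n] from the differentiated letter plus a quarter of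
    [4 q M / 2^n] is [4 q M / 2^(n+1)]. *)
Lemma dwterm_le n d z j x M :
  (forall k, `|z ord0 k| <= r) -> word_bound d x M ->
  `|dwterm n d z j x| <= q * M * 4 / 2 ^+ n.
Proof.
move=> zr; elim: n d M => [|n IH] d M dM /=.
  by rewrite normr0 expr0 divr1 !mulr_ge0// (word_bound_ge0 dM).
have M0 := word_bound_ge0 dM.
rewrite (le_trans (ler_normD _ _))//.
have : `|\sum_k z ord0 k *: dwterm n (fun t => d (k :: t)) z j x| <=
    (q * M * 4 / 2 ^+ n) / 4.
  apply: norm_zsum_quarter => // [|k].
    by rewrite divr_ge0 ?exprn_ge0 ?mulr_ge0.
  have := IH _ _ (word_boundS k dM); rewrite !mulrA; exact.
move=> /(lerD (wterm_le n zr (word_boundS j dM)))/le_trans; apply.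
have p0 : 2 ^+ n != 0 :> C by rewrite expf_neq0.
by rewrite le_eqVlt (exprS 2 n); apply/orP; left; apply/eqP; field; rewrite p0.
Qed.

(** Product rule at the first letter: either that letter changes, costing [N e q M / 2^n], or the
    rest does, costing a quarter of the inductive bound. The factor [4 N] makes the two equal. *)
Lemma wterm_lipschitz n d z h x M (e : C) : 0 <= e ->
  (forall k, `|z ord0 k| <= r) -> (forall k, `|(z + h) ord0 k| <= r) ->
  (forall k, `|h ord0 k| <= e) -> word_bound d x M ->
  `|wterm n d (z + h) x - wterm n d z x| <= q * e * M * (4 * N%:R) / 2 ^+ n.
Proof.
move=> e0 zr zhr he; elim: n d M => [|n IH] d M dM /=.
  by rewrite subrr normr0 expr0 divr1 !mulr_ge0// (word_bound_ge0 dM).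
have M0 := word_bound_ge0 dM.
have -> : \sum_k (z + h) ord0 k *: wterm n (fun t => d (k :: t)) (z + h) x -
    \sum_k z ord0 k *: wterm n (fun t => d (k :: t)) z x =
    \sum_k h ord0 k *: wterm n (fun t => d (k :: t)) (z + h) x +
    \sum_k z ord0 k *: (wterm n (fun t => d (k :: t)) (z + h) x -
                        wterm n (fun t => d (k :: t)) z x).
  rewrite -sumrB -big_split/=; apply: eq_bigr => k _.
  by rewrite mxE scalerDl scalerBr addrA [X in X - _ = _]addrC.
rewrite (le_trans (ler_normD _ _))//.
have : `|\sum_k z ord0 k *: (wterm n (fun t => d (k :: t)) (z + h) x -
                        wterm n (fun t => d (k :: t)) z x)| <=
    (q * e * M * (4 * N%:R) / 2 ^+ n) / 4.
  apply: norm_zsum_quarter => // [|k].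
    by rewrite divr_ge0 ?exprn_ge0 ?mulr_ge0.
  apply: le_trans (IH _ _ (word_boundS k dM)) _.
  by rewrite le_eqVlt; apply/orP; left; apply/eqP; ring.
have V0 : 0 <= q * M / 2 ^+ n by rewrite divr_ge0 ?exprn_ge0 ?mulr_ge0.
have := norm_zsum_le V0 he (fun k => wterm_le n zhr (word_boundS k dM)).
move=> /lerD H /H /le_trans; apply.
have p0 : 2 ^+ n != 0 :> C by rewrite expf_neq0.
by rewrite le_eqVlt (exprS 2 n); apply/orP; left; apply/eqP; field; rewrite p0.
Qed.

(** At the first letter the remainder splits into [h_k] times a difference, of second order by
    [wterm_lipschitz], and [z_k] times the remainder of the shorter words. *)
Lemma wterm_taylor n d z h x M (e : C) : 0 <= e ->
  (forall k, `|z ord0 k| <= r) -> (forall k, `|(z + h) ord0 k| <= r) ->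
  (forall k, `|h ord0 k| <= e) -> word_bound d x M ->
  `|wterm n d (z + h) x - wterm n d z x - \sum_j h ord0 j *: dwterm n d z j x|
    <= (q * e) ^+ 2 * M * (4 * N%:R) ^+ 2 / 2 ^+ n.
Proof.
move=> e0 zr zhr he; elim: n d M => [|n IH] d M dM /=.
  rewrite subrr sub0r normrN big1 ?normr0; last by move=> k _; rewrite scaler0.
  by rewrite expr0 divr1 !mulr_ge0 ?exprn_ge0 ?mulr_ge0// (word_bound_ge0 dM).
have M0 := word_bound_ge0 dM.
pose w k z := wterm n (fun t => d (k :: t)) z x.
pose dw k j := dwterm n (fun t => d (k :: t)) z j x.
rewrite (_ : _ - _ - _ = \sum_k h ord0 k *: (w k (z + h) - w k z) +
    \sum_k z ord0 k *: (w k (z + h) - w k z - \sum_j h ord0 j *: dw k j));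
    last first.
  under [X in _ - X = _]eq_bigr do rewrite scalerDr scaler_sumr.
  rewrite big_split/= exchange_big/= opprD addrA -!sumrB -big_split/=.
  apply: eq_bigr => k _; rewrite mxE scalerDl !scalerBr scaler_sumr -/(w k _).
  rewrite -/(w k _) !addrA; congr (_ - _); last first.
    by apply: eq_bigr => j _; rewrite !scalerA mulrC.
  by rewrite [LHS](ACl (2*4*1*3)%AC).
rewrite (le_trans (ler_normD _ _))//.
have : `|\sum_k z ord0 k *: (w k (z + h) - w k z -
                             \sum_j h ord0 j *: dw k j)| <=
    ((q * e) ^+ 2 * M * (4 * N%:R) ^+ 2 / 2 ^+ n) / 4.
  apply: norm_zsum_quarter => // [|k].
    by rewrite divr_ge0 ?exprn_ge0 ?mulr_ge0 ?exprn_ge0 ?mulr_ge0.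
  apply: le_trans (IH _ _ (word_boundS k dM)) _.
  by rewrite le_eqVlt; apply/orP; left; apply/eqP; ring.
have V0 : 0 <= q * e * (q * M) * (4 * N%:R) / 2 ^+ n.
  by rewrite divr_ge0 ?exprn_ge0 ?mulr_ge0.
have := norm_zsum_le V0 he
  (fun k => wterm_lipschitz n e0 zr zhr he (word_boundS k dM)).
move=> /lerD H /H /le_trans; apply.
have p0 : 2 ^+ n != 0 :> C by rewrite expf_neq0.
by rewrite le_eqVlt (exprS 2 n); apply/orP; left; apply/eqP; field; rewrite p0.
Qed.

End Bounds.
End Terms.

(** * Holomorphy of word series *)

Section Holomorphy.
Variables (A : normedModType C) (B : completeNormedModType C).
Variables (d : seq 'I_N -> A -> B) (M q r : C).
Hypotheses (q0 : 0 <= q) (qr : N%:R * (r * q) <= 4^-1).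
Hypothesis d_op : forall t, bounded_op (d t).
Hypothesis dM : forall t x, `|d t x| <= M * q ^+ size t * `|x|.

Definition wseries z x : B := seqsum (fun n => wterm n d z x).
Definition dwseries z j x : B := seqsum (fun n => dwterm n d z j x).

Let dMx x : word_bound q d x (M * `|x|).
Proof. by move=> t; rewrite mulrAC. Qed.

Let coord_lt z : `|z| < r -> forall k, `|z ord0 k| <= r.
Proof. by move=> /ltW zr k; rewrite (le_trans (mx_coord_le _ _)). Qed.

Lemma wterm_geometric z x : `|z| < r ->
  geometric_bound (fun n => wterm n d z x) (M * `|x|).
Proof. move=> /coord_lt zr n; exact: (wterm_le q0 qr). Qed.

Lemma dwterm_geometric z j x : `|z| < r ->
  geometric_bound (fun n => dwterm n d z j x) (q * (M * `|x|) * 4).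
Proof. move=> /coord_lt zr n; exact: (dwterm_le q0 qr). Qed.

Lemma wseries_bounded_op z : `|z| < r -> bounded_op (wseries z).
Proof.
move=> zr; apply: (@bounded_op_of_bound _ _ _ _ (M * 2)) => [a x y|x].
  rewrite -(seqsum_linear a (wterm_geometric x zr) (wterm_geometric y zr)).
  by congr seqsum; apply/funext => n; exact: wterm_linear.
by rewrite (le_trans (seqsum_le (wterm_geometric x zr)))// mulrAC.
Qed.

Lemma dwseries_bounded_op z j : `|z| < r -> bounded_op (dwseries z j).
Proof.
move=> zr; apply: (@bounded_op_of_bound _ _ _ _ (q * M * 4 * 2)) => [a x y|x].
  rewrite -(seqsum_linear a (dwterm_geometric j x zr) (dwterm_geometric j y zr)).
  by congr seqsum; apply/funext => n; exact: dwterm_linear.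
rewrite (le_trans (seqsum_le (dwterm_geometric j x zr)))//.
by rewrite le_eqVlt; apply/orP; left; apply/eqP; ring.
Qed.

(** The termwise Taylor remainders sum to a multiple of [|h|^2 |x|], so the termwise derivative is
    the Frechet derivative. *)
Lemma wseries_holomorphic :
  holomorphic_on [set z | `|z| < r] wseries.
Proof.
have M0 (x : A) : 0 <= M * `|x| by exact: word_bound_ge0 (dMx x).
split; first exact: (@open_norm_lt _ 'rV[C]_N).
split; first exact: wseries_bounded_op.
move=> z0 /= z0r; exists (dwseries z0); split.
  by move=> j; exact: dwseries_bounded_op.
move=> e e0.
(* The constant of [wterm_taylor], doubled by [seqsum_le]; adding 1 makes it positive. *)
pose c := q ^+ 2 * `|M| * (4 * N%:R) ^+ 2 * 2 + 1.
have c0 : 0 < c.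
  by rewrite ltr_wpDl// !mulr_ge0 ?exprn_ge0 ?mulr_ge0.
have s0 : 0 < r - `|z0| by rewrite subr_gt0.
(* Below [e / c] the quadratic remainder is at most [e |h| |x|]; below [r - |z0|] the point [z]
   stays in the ball. *)
have [dl dl0 [dle dls]] := le_pair_gt0 (divr_gt0 e0 c0) s0.
exists dl => // z zdl x; set h := z - z0.
have zE : z = z0 + h by rewrite addrC subrK.
have zr : `|z| < r.
  rewrite zE (le_lt_trans (ler_normD _ _))// addrC -ltrBrDr.
  exact: lt_le_trans zdl dls.
have -> : wseries z x - wseries z0 x - zop h (dwseries z0) x =
    seqsum (fun n => wterm n d (z0 + h) x - wterm n d z0 x -
                     \sum_j h ord0 j *: dwterm n d z0 j x).
  have [M' gb seqE] := seqsum_sum (fun j => h ord0 j)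
    (fun j => dwterm_geometric j x z0r).
  have bz := wterm_geometric x zr; have bz0 := wterm_geometric x z0r.
  by rewrite /zop -seqE -(seqsumB bz bz0) -(seqsumB (geometric_boundB bz bz0) gb) -zE.
have bR : geometric_bound (fun n => wterm n d (z0 + h) x - wterm n d z0 x -
    \sum_j h ord0 j *: dwterm n d z0 j x)
    ((q * `|h|) ^+ 2 * (M * `|x|) * (4 * N%:R) ^+ 2).
  move=> n; apply: (wterm_taylor q0 qr) => //; first exact: coord_lt.
    by rewrite -zE; exact: coord_lt.
  exact: mx_coord_le.
apply: le_trans (seqsum_le bR) _.
apply: (@le_trans _ _ (c * `|h| * (`|h| * `|x|))).
  have -> : (q * `|h|) ^+ 2 * (M * `|x|) * (4 * N%:R) ^+ 2 * 2 =
    q ^+ 2 * (M * `|x|) * (4 * N%:R) ^+ 2 * 2 * (`|h| * `|h|) by ring.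
  have -> : c * `|h| * (`|h| * `|x|) = c * `|x| * (`|h| * `|h|) by ring.
  rewrite ler_wpM2r ?mulr_ge0// /c [leRHS]mulrDl mul1r ler_wpDr//.
  rewrite -(ger0_norm (M0 x)) normrM normr_id le_eqVlt; apply/orP; left.
  by apply/eqP; ring.
rewrite [leRHS](_ : _ = e * (`|h| * `|x|)) ?mulrA// -!mulrA.
rewrite mulrA ler_wpM2r ?mulr_ge0// mulrC -ler_pdivlMr//.
by apply: le_trans dle; exact: ltW.
Qed.

End Holomorphy.
End WordSeries.

(** * Roots of unity and their orthogonality *)

Section RootsOfUnity.
Variable K : numClosedFieldType.

(** The polynomial [X^n - 1] splits and is separable, so it has [n] distinct roots, and these
    include a primitive one. *)
Lemma prim_root_exists n : (0 < n)%N -> exists z : K, n.-primitive_root z.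
Proof.
move=> n0; have [r] := closed_field_poly_normal ('X^n - 1 : {poly K}).
rewrite (monicP (monicXnsubC 1 n0)) scale1r => rE.
have Ur : uniq r.
  by rewrite -separable_prod_XsubC -rE separable_Xn_sub_1// pnatr_eq0 -lt0n.
have r1 : all n.-unity_root r.
  by apply/allP => z; rewrite -root_prod_XsubC -rE.
have sr : (n <= size r)%N.
  by rewrite -ltnS -(size_prod_XsubC r id) -rE size_XnsubC.
by have /hasP[z _ zP] := has_prim_root n0 r1 Ur sr; exists z.
Qed.

Lemma prim_root_norm n (z : K) : n.-primitive_root z -> `|z| = 1.
Proof.
move=> zP; have n0 := prim_order_gt0 zP; apply/eqP.
by rewrite -(pexpr_eq1 n0)// -normrX (prim_expr_order zP) normr1.
Qed.

(** A geometric sum with ratio [w] such that [w^n = 1]: unless [w = 1], multiplying by [w - 1] gives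
    0. The bounds on [a] and [b] make distinct exponents give distinct powers. *)
Lemma prim_root_orthogonality n (z : K) (a b : nat) :
  n.-primitive_root z -> (a < n)%N -> (b < n)%N ->
  \sum_(i < n) (z ^+ i) ^+ a / (z ^+ i) ^+ b = if a == b then n%:R else 0.
Proof.
move=> zP an bn; have z0 : z != 0 by rewrite -normr_eq0 (prim_root_norm zP) oner_eq0.
under eq_bigr do rewrite -!exprM ![(_ * a)%N]mulnC ![(_ * b)%N]mulnC !exprM -expr_div_n.
set w := z ^+ a / z ^+ b.
case: eqP => [ab|/eqP ab].
  rewrite /w ab divff ?expf_neq0//; under eq_bigr do rewrite expr1n.
  by rewrite sumr_const card_ord.
have w1 : w - 1 != 0.
  rewrite subr_eq0; apply: contra ab => /eqP w1.
  have /eqP : z ^+ a = z ^+ b.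
    by rewrite -[LHS](divfK (expf_neq0 b z0)) -/w w1 mul1r.
  by rewrite (eq_prim_root_expr zP) !modn_small.
apply: (mulfI w1); rewrite -subrX1 mulr0 /w expr_div_n -!exprM.
by rewrite ![(_ * n)%N]mulnC !exprM (prim_expr_order zP) !expr1n divr1 subrr.
Qed.

End RootsOfUnity.

(** * Discrete Cauchy estimates in one and several variables *)

Section CauchyEstimates.
Variables (R : realType) (N : nat).
Local Notation C := (Cx R).

(* Averaging the partial sums of length k over the k-th roots of unity isolates
   the coefficient a n exactly, so only the tails of the series are lost. *)
Lemma cauchy_estimate (B : completeNormedModType C) (a : nat -> B) (D M : C) :
  geometric_bound a D ->
  (forall w : C, `|w| = 1 -> `|seqsum (fun n => w ^+ n *: a n)| <= M) ->
  forall n, `|a n| <= M.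
Proof.
move=> aD wM n; apply/ler_addgt0Pl => e e0.
have D0 := geometric_bound_ge0 aD.
have D20 : 0 <= D * 2 by rewrite mulr_ge0.
have [l lP] := geometric_small D20 e0.
(* Since [k > n], orthogonality singles out [a n]; since [k >= l], the tail beyond [k] is below
   [e]. *)
pose k := (l + n.+1)%N; have k0 : (0 < k)%N by rewrite /k addnS.
have nk : (n < k)%N by rewrite /k leq_addl.
have [z zP] := prim_root_exists C k0; have z1 := prim_root_norm zP.
have kC0 : (k%:R : C) != 0 by rewrite pnatr_eq0 -lt0n.
have aE : k%:R *: a n =
    \sum_(i < k) (z ^+ i) ^- n *: \sum_(j < k) (z ^+ i) ^+ j *: a j.
  under eq_bigr do rewrite scaler_sumr.
  rewrite exchange_big/= (bigD1 (Ordinal nk))//= [X in _ = _ + X]big1 => [|j jn].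
    rewrite addr0; under eq_bigr do rewrite scalerA mulrC.
    by rewrite -scaler_suml (prim_root_orthogonality zP)// eqxx.
  under eq_bigr do rewrite scalerA mulrC.
  rewrite -scaler_suml (prim_root_orthogonality zP)//.
  by rewrite -(inj_eq val_inj)/= in jn; rewrite (negbTE jn) scale0r.
have k0' : (0 : C) < k%:R by rewrite ltr0n.
rewrite -(ler_pM2l k0') -{1}(ger0_norm (ltW k0')) -normrZ aE.
rewrite (le_trans (ler_norm_sum _ _ _))//.
apply: (@le_trans _ _ (\sum_(i < k) (e + M))); last first.
  by rewrite sumr_const card_ord mulr_natl.
apply: ler_sum => i _.
have w1 : `|z ^+ i| = 1 by rewrite normrX z1 expr1n.
rewrite normrZ normfV normrX w1 expr1n invr1 mul1r.
have bD : geometric_bound (fun j => (z ^+ i) ^+ j *: a j) D.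
  by move=> j; rewrite normrZ normrX w1 expr1n mul1r.
have := seqsum_tail k bD; rewrite distrC => /lerD/(_ (wM _ w1)).
move=> /(le_trans (ler_normD _ _)); rewrite subrK => /le_trans; apply.
rewrite lerD2r (le_trans _ (ltW lP))// ler_wpM2l//.
by rewrite lef_pV2 ?posrE ?exprn_gt0// ler_eXn2l ?ltr1n// /k leq_addr.
Qed.

Lemma prod_scale_seq (I : Type) (w : C) (F : I -> C) (s : seq I) :
  \prod_(i <- s) (w * F i) = w ^+ size s * \prod_(i <- s) F i.
Proof.
elim: s => [|i s IH]; first by rewrite !big_nil mulr1.
by rewrite !big_cons IH exprS mulrACA.
Qed.

Lemma prod_count_seq (F : 'I_N -> C) (s : seq 'I_N) :
  \prod_(i <- s) F i = \prod_k F k ^+ count_mem k s.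
Proof.
elim: s => [|i s IH]; first by rewrite big_nil big1.
rewrite big_cons IH; under [RHS]eq_bigr do rewrite /= exprD.
rewrite big_split/=; congr (_ * _).
rewrite (bigD1 i)//= eqxx big1 ?mulr1// => k ki.
by rewrite eq_sym (negbTE ki).
Qed.

Definition word_sort (s : seq 'I_N) := sort (fun i j : 'I_N => (i <= j)%N) s.

(** A sorted word is determined by its letter counts, the exponents of its monomial, and these are
    what roots of unity detect. *)
Lemma word_sort_eq (s t : seq 'I_N) :
  word_sort s = s -> (word_sort t == s) = [forall k, count_mem k t == count_mem k s].
Proof.
move=> sE; apply/eqP/forallP => [<- k|ts].
  by apply/eqP/permP; rewrite perm_sym perm_sort.
rewrite -sE; apply/perm_sortP.
- by move=> i j; exact: leq_total.
- by move=> i j k; exact: leq_trans.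
- by move=> i j ij; apply/val_inj/anti_leq.
- by rewrite /perm_eq; apply/allP => k _; exact: ts.
Qed.

Lemma word_sort_id (s : seq 'I_N) : word_sort (word_sort s) = word_sort s.
Proof.
rewrite /word_sort sorted_sort//; first by move=> i j k; exact: leq_trans.
by apply: sort_sorted => i j; exact: leq_total.
Qed.

Section Coefficients.
Variables (A B : normedModType C).

(* All words with the same letters are merged into the coefficient of the
   sorted word: only these merged coefficients obey Cauchy estimates. *)
Definition sorted_coef n (c : n.-tuple 'I_N -> A -> B) (s : seq 'I_N) (x : A) : B :=
  \sum_(t : n.-tuple 'I_N | word_sort t == s) c t x.

(** Group the words by their sorted form; the scalars commute, so the monomial is constant on each
    group. *)
Lemma sorted_coef_sum n (c : n.-tuple 'I_N -> A -> B) (z : 'rV[C]_N) x :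
  \sum_(s : n.-tuple 'I_N) (\prod_(i <- s) z ord0 i) *: sorted_coef c s x =
  \sum_(s : n.-tuple 'I_N) (\prod_(i <- s) z ord0 i) *: c s x.
Proof.
rewrite [RHS](partition_big
  (fun t : n.-tuple 'I_N => [tuple of word_sort t]) xpredT)//=.
apply: eq_bigr => s _; rewrite /sorted_coef scaler_sumr.
apply: eq_big => [t|t /eqP <-]; first by rewrite -(inj_eq val_inj).
by congr (_ *: _); apply: perm_big; rewrite perm_sort.
Qed.

Lemma sorted_coef_bounded_op n (c : n.-tuple 'I_N -> A -> B) s :
  (forall t, bounded_op (c t)) -> bounded_op (sorted_coef c s).
Proof.
move=> cb; split=> [a x y|x].
  rewrite /sorted_coef scaler_sumr -big_split/=; apply: eq_bigr => t _.
  exact: (cb t).1.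
rewrite /sorted_coef; apply: cvg_big => [|t _]; last exact: (cb t).2.
exact: add_continuous.
Qed.

(** Average the polynomial over all points with coordinates [r] times a root of unity, weighted by
    the inverse monomial of [s]; only the words with the letter counts of [s] survive. *)
Lemma sorted_coef_le n (c : n.-tuple 'I_N -> A -> B) (r M : C) x (s : seq 'I_N) :
  0 < r -> 0 <= M -> size s = n ->
  (forall z : 'rV[C]_N, `|z| <= r ->
    `|\sum_(t : n.-tuple 'I_N) (\prod_(i <- t) z ord0 i) *: c t x| <= M) ->
  `|sorted_coef c s x| <= M * r^-1 ^+ n.
Proof.
move=> r0 M0 sn PM.
(* For an unsorted [s] the defining sum is empty. *)
have [sE|sE] := eqVneq (word_sort s) s; last first.
  rewrite /sorted_coef big1 ?normr0 ?mulr_ge0 ?exprn_ge0 ?invr_ge0 ?(ltW r0)//.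
  by move=> t /eqP ts; case/eqP: sE; rewrite -ts word_sort_id.
(* Exponents run from 0 to [n], so order [n.+1] separates them. *)
have [zt ztP] := prim_root_exists C (ltn0Sn n); have z1 := prim_root_norm ztP.
pose u (g : {ffun 'I_N -> 'I_n.+1}) : C :=
  \prod_k (zt ^+ g k) ^- count_mem k s.
pose v (g : {ffun 'I_N -> 'I_n.+1}) : 'rV[C]_N := \row_k (r * zt ^+ g k).
pose P (z : 'rV[C]_N) := \sum_(t : n.-tuple 'I_N) (\prod_(i <- t) z ord0 i) *: c t x.
pose k := (n.+1%:R : C) ^+ N.
have k0 : 0 < k by rewrite exprn_gt0.
have key : \sum_g u g *: P (v g) = (k * r ^+ n) *: sorted_coef c s x.
  rewrite /P; under eq_bigr do rewrite scaler_sumr.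
  rewrite exchange_big/= /sorted_coef scaler_sumr [RHS]big_mkcond/=.
  apply: eq_bigr => t _; rewrite word_sort_eq//.
  under eq_bigr => g _.
    rewrite scalerA; under [X in _ * X]eq_bigr do rewrite mxE.
    rewrite prod_scale_seq size_tuple mulrCA prod_count_seq -big_split/=.
    under eq_bigr do rewrite mulrC.
    over.
  rewrite -scaler_suml -mulr_sumr.
  (* The sum over tuples of roots factors into one orthogonality sum per variable. *)
  rewrite -(bigA_distr_bigA (fun j (i : 'I_n.+1) =>
    (zt ^+ i) ^+ count_mem j t / (zt ^+ i) ^+ count_mem j s))/=.
  have ct (w : seq 'I_N) j : size w = n -> (count_mem j w < n.+1)%N.
    by move=> <-; rewrite ltnS count_size.
  under eq_bigr do rewrite (prim_root_orthogonality ztP)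
    ?(ct _ _ sn) ?(ct _ _ (size_tuple t))//.
  case: ifPn => [/forallP ts|].
    under eq_bigr do rewrite ts.
    by rewrite prodr_const card_ord mulrC.
  rewrite negb_forall => /existsP[j /negbTE js].
  by rewrite (bigD1 j)//= js mul0r mulr0 scale0r.
have rn0 : 0 < r ^+ n by rewrite exprn_gt0.
rewrite exprVn ler_pdivlMr// -(ler_pM2l k0) mulrA [k * _ * _]mulrAC.
rewrite -{1}(ger0_norm (ltW (mulr_gt0 k0 rn0))) -normrZ -key.
rewrite (le_trans (ler_norm_sum _ _ _))//.
apply: (@le_trans _ _ (\sum_(g : {ffun 'I_N -> 'I_n.+1}) M)); last first.
  by rewrite sumr_const card_ffun !card_ord -mulr_natl natrX.
have w1 i : `|zt ^+ i| = 1 by rewrite normrX z1 expr1n.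
apply: ler_sum => g _; rewrite normrZ /u normr_prod big1 ?mul1r.
  apply/PM/mx_norm_le => [|j]; first exact: ltW.
  by rewrite mxE normrM w1 mulr1 gtr0_norm.
by move=> j _; rewrite normfV normrX w1 expr1n invr1.
Qed.

End Coefficients.
End CauchyEstimates.

(** * From a holomorphic function to a dominated word series *)

Section WordExpansion.
Variables (R : realType) (N : nat).
Local Notation C := (Cx R).
Implicit Type z : 'rV[C]_N.

Definition word_coefficients (A B : normedModType C) (M q : C) (m : nat)
    (d : seq 'I_N -> A -> B) : Prop :=
  [/\ forall t, bounded_op (d t),
      forall t x, `|d t x| <= M * q ^+ size t * `|x|,
      forall t x, (size t < m)%N -> d t x = 0 &
      exists t x, size t = m /\ d t x != 0].

(** Differentiability at 0 with error [eps = 1] suffices: value, derivative and error are each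
    bounded there. *)
Lemma holomorphic_locally_bounded (A B : normedModType C) (G : set 'rV[C]_N)
    (f : 'rV[C]_N -> A -> B) : G 0 -> holomorphic_on G f ->
  exists r M : C, [/\ 0 < r, 0 <= M &
    forall z, `|z| < r -> forall x, `|f z x| <= M * `|x|].
Proof.
move=> G0 [_ [fb /(_ 0 G0)[D [Db /(_ 1 ltr01)[dl dl0 fD]]]]].
have [M0 M00 f0] := bounded_op_bound (fb 0 G0).
have /choice[Mk MkP] : forall k, exists M, 0 <= M /\ forall x, `|D k x| <= M * `|x|.
  by move=> k; have [M /ltW M1 MP] := bounded_op_bound (Db k); exists M.
have [r r0 [rdl r1]] := le_pair_gt0 dl0 ltr01.
have S0 : 0 <= \sum_k Mk k by rewrite sumr_ge0// => k _; case: (MkP k).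
exists r, (1 + \sum_k Mk k + M0); split => //.
  by rewrite !addr_ge0 ?ler01// ltW.
move=> z zr x; have z1 : `|z| <= 1 by rewrite (le_trans (ltW zr)).
have zdl : `|z - 0| < dl by rewrite subr0 (lt_le_trans zr).
have -> : f z x = (f z x - f 0 x - zop (z - 0) D x) + zop (z - 0) D x + f 0 x.
  by rewrite !subrK.
rewrite !mulrDl (le_trans (ler_normD _ _))// lerD// (le_trans (ler_normD _ _))//.
apply: lerD.
  rewrite (le_trans (fD _ zdl _))// mul1r ler_wpM2r//.
  by rewrite subr0.
rewrite subr0 /zop mulr_suml (le_trans (ler_norm_sum _ _ _))//.
apply: ler_sum => k _; rewrite normrZ -[leRHS]mul1r ler_pM//.
  exact: le_trans (mx_coord_le _ _) z1.
by case: (MkP k).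
Qed.

Lemma homogeneous_polyZ (A B : normedModType C) n (P : 'rV[C]_N -> A -> B) w z x :
  homogeneous_poly n P -> P (w *: z) x = w ^+ n *: P z x.
Proof.
move=> [c [_ PE]]; rewrite !PE scaler_sumr; apply: eq_bigr => t _.
under eq_bigr do rewrite mxE.
by rewrite prod_scale_seq size_tuple scalerA.
Qed.

Section Taylor.
Variables (A : normedModType C) (B : completeNormedModType C).
Variables (f : 'rV[C]_N -> A -> B) (P : nat -> 'rV[C]_N -> A -> B) (V : set 'rV[C]_N).
Hypothesis P_homog : forall n, homogeneous_poly n (P n).
Hypothesis f_cvg : forall z, V z -> forall e : C, 0 < e ->
  exists M, forall n, (M <= n)%N ->
    forall x, `|f z x - \sum_(k < n) P k z x| <= e * `|x|.

Lemma homogeneous_expansion z x : V z -> seqsum (fun n => P n z x) = f z x.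
Proof.
move=> Vz; apply: seqsum_unique => e e0.
have x0 : 0 < `|x| + 1 by rewrite ltr_wpDl.
have [m mP] := f_cvg Vz (divr_gt0 e0 x0).
exists m => n mn; rewrite (le_trans (mP n mn x))// -mulrA ger_pMr//.
by rewrite ler_pdivrMl// mulr1 lerDl.
Qed.

(** Convergence at [2 z] bounds the terms there, and homogeneity turns this into decay [2^-n] at
    [z]. *)
Lemma homogeneous_geometric z x : V (2 *: z) ->
  exists D, geometric_bound (fun n => P n z x) D.
Proof.
move=> V2; have [m mP] := f_cvg V2 ltr01.
(* From [m] on, a term is the difference of two partial sums, each within [|x|] of the limit; the
   finitely many earlier terms are added in. *)
pose D := `|x| + `|x| + \sum_(k < m) `|P k (2 *: z) x|.
exists D => n; rewrite ler_pdivlMr ?exprn_gt0// mulrC.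
have -> : 2 ^+ n * `|P n z x| = `|P n (2 *: z) x|.
  by rewrite (homogeneous_polyZ _ _ _ (P_homog n)) normrZ normrX ger0_norm.
have [mn|nm] := leqP m n; last first.
  by rewrite /D (bigD1 (Ordinal nm))//= addrCA lerDl !addr_ge0// sumr_ge0.
apply: (@le_trans _ _ (`|x| + `|x|)); last by rewrite lerDl sumr_ge0.
have := mP _ mn x; have := mP _ (leqW mn) x; rewrite mul1r distrC => a b.
have := lerD a b; apply: le_trans; rewrite (le_trans _ (ler_normD _ _))//.
by rewrite addrA subrK big_ord_recr/= addrAC subrr add0r.
Qed.

(** Apply [cauchy_estimate] on the circle [w z], where [f] is the series of the [w^n P_n(z)]. The
    radius is halved so that [2 z] stays in [V], as domination requires. *)
Lemma homogeneous_cauchy (r M : C) n z x :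
  (forall z, `|z| < r -> V z) ->
  (forall z, `|z| < r -> forall x, `|f z x| <= M * `|x|) ->
  `|z| < r / 2 -> `|P n z x| <= M * `|x|.
Proof.
move=> rV fM zr; have zr2 : `|2 *: z| < r.
  by rewrite normrZ ger0_norm// mulrC -ltr_pdivlMr.
have zr1 : `|z| < r.
  by rewrite (le_lt_trans _ zr2)// normrZ ger0_norm// ler_peMl// ler1n.
have [D PD] := homogeneous_geometric x (rV _ zr2).
apply: (cauchy_estimate PD) => w w1.
have wr : `|w *: z| < r by rewrite normrZ w1 mul1r.
under eq_fun do rewrite -(homogeneous_polyZ _ _ _ (P_homog _)).
by rewrite (homogeneous_expansion _ (rV _ wr)) fM.
Qed.

End Taylor.

Lemma word_expansion (A : normedModType C) (B : completeNormedModType C)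
    (G : set 'rV[C]_N) (f : 'rV[C]_N -> A -> B) m :
  G 0 -> holomorphic_on G f -> zero_multiplicity f m ->
  exists d M (q s : C), [/\ 0 < q, 0 < s, word_coefficients M q m d &
    forall z, `|z| < s -> forall x, f z x = wseries d z x].
Proof.
move=> G0 hf [V [P [[oV V0] hP fP P0 [z0 [x0 Pm]]]]].
have [r1 [M [r10 M0 fM]]] := holomorphic_locally_bounded G0 hf.
have [r2 r20 rV] := @open_norm_ball _ 'rV[C]_N _ oV V0.
have [r r0 [rr1 rr2]] := le_pair_gt0 r10 r20.
have {}fM z : `|z| < r -> forall x, `|f z x| <= M * `|x|.
  by move=> zr; apply: fM; exact: lt_le_trans zr rr1.
have {}rV z : `|z| < r -> V z by move=> zr; apply: rV; exact: lt_le_trans zr rr2.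
(* Strictly below [r / 2]: [sorted_coef_le] needs a closed ball inside the open ball of
   [homogeneous_cauchy]. *)
pose p := r / 4.
have p0 : 0 < p by rewrite divr_gt0.
have pr : p < r / 2 by rewrite ltr_pM2l// ltf_pV2 ?posrE// ltr_nat.
pose c n := projT1 (cid (hP n)).
have cop n t : bounded_op (c n t).
  by have [+ _] := projT2 (cid (hP n)); exact.
have cP n z x : P n z x =
    \sum_(t : n.-tuple 'I_N) (\prod_(i <- t) z ord0 i) *: c n t x.
  by have [_] := projT2 (cid (hP n)); exact.
pose d (t : seq 'I_N) := sorted_coef (c (size t)) t.
have dE n (t : seq 'I_N) : size t = n -> d t = sorted_coef (c n) t by move=> <-.
have PE n z x : P n z x = wterm n d z x.
  rewrite wterm_tuple cP -sorted_coef_sum; apply: eq_bigr => t _.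
  by rewrite (dE n) ?size_tuple.
have q0 : 0 < p^-1 by rewrite invr_gt0.
exists d, M, p^-1, r; split=> //; last first.
  move=> z zr x; rewrite -(homogeneous_expansion fP x (rV _ zr)).
  by congr seqsum; apply/funext => n; rewrite PE.
split.
- by move=> t; exact: sorted_coef_bounded_op.
- move=> t x; rewrite mulrAC; apply: sorted_coef_le => //.
    by rewrite mulr_ge0.
  move=> z zp; rewrite -cP.
  exact: (homogeneous_cauchy hP fP (size t) x rV fM (le_lt_trans zp pr)).
(* A zero polynomial may have nonzero coefficients [c], cancelling between orderings of a word; the
   merged ones vanish, by the estimate with constant 0. *)
- move=> t x tm; apply/eqP; rewrite -normr_le0.
  rewrite -[leRHS](mul0r (p^-1 ^+ size t)); apply: sorted_coef_le => // z _.
  by rewrite -cP P0// normr0.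
- apply: contrapT => dm; case/eqP: Pm; rewrite PE wterm_tuple big1// => t _.
  rewrite (_ : d t x0 = 0) ?scaler0//; apply: contrapT => /eqP dt.
  by apply: dm; exists t, x0; rewrite size_tuple.
Qed.

End WordExpansion.

(** * Peeling off letters and iterating *)

Section Factorization.
Variables (R : realType) (N : nat).
Local Notation C := (Cx R).
Implicit Type z : 'rV[C]_N.

Section Step.
Variables (A : normedModType C) (B : completeNormedModType C).
Implicit Type d : seq 'I_N -> A -> B.

Definition peel d (t : seq 'I_N) (x : A) : l2pow N B :=
  [ffun k => d (k :: t) x].

Lemma wterm_peel n d z x k :
  wterm n (peel d) z x k = wterm n (fun t => d (k :: t)) z x.
Proof.
rewrite !wterm_tuple.
elim/big_rec2 : _ => [|t u v _ <-]; first by rewrite ffunE.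
by rewrite !ffunE.
Qed.

(** The column norm is at most the sum of [N] coordinates, each belonging to a word one letter
    longer. Only [M] changes: [q] is kept, so one radius serves all steps. *)
Lemma peel_word_coefficients d (M q : C) m : 0 <= q ->
  word_coefficients M q m.+1 d ->
  word_coefficients (N%:R * (M * q)) q m (peel d).
Proof.
move=> q0 [dop dM d0 [t0 [x0 [st dt]]]].
have pM t x : `|peel d t x| <= N%:R * (M * q) * q ^+ size t * `|x|.
  rewrite l2pow_norm (le_trans (l2norm_le_sum _))//.
  rewrite (_ : _ * `|x| = \sum_(k < N) M * q ^+ (size t).+1 * `|x|).
    by apply: ler_sum => k _; rewrite ffunE; exact: (dM (k :: t)).
  by rewrite sumr_const card_ord -[RHS]mulr_natl exprS !mulrA.
split => //.
- move=> t; apply: bounded_op_of_bound (pM t) => a x y.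
  by apply/ffunP => k; rewrite !ffunE; exact: (dop _).1.
- by move=> t x tm; apply/ffunP => k; rewrite !ffunE d0.
- case: t0 st dt => [//|k t0] [st] dt; exists t0, x0; split => //.
  by apply: contra dt => /eqP/ffunP/(_ k); rewrite !ffunE => ->.
Qed.

(** The empty word has coefficient 0, so the series starts in degree one and every term has a first
    letter to split off; the coordinates commute with the sum by continuity. *)
Lemma wseries_peel d (M q r : C) m z x :
  0 <= q -> N%:R * (r * q) <= 4^-1 ->
  word_coefficients M q m.+1 d -> `|z| < r ->
  wseries d z x = zop z (fun k (y : l2pow N B) => y k) (wseries (peel d) z x).
Proof.
move=> q0 qr dW zr; have [dop dM d0 _] := dW.
have [_ pM _ _] := peel_word_coefficients q0 dW.
rewrite /wseries (seqsumS (wterm_geometric q0 qr dM x zr)); last exact: d0.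
have pb := wterm_geometric q0 qr pM x zr.
rewrite /zop.
under eq_bigr => k _ do rewrite -(seqsum_op (coord_bounded_op B k) pb).
have [|_ _ <-] := @seqsum_sum _ _ _ (fun k => z ord0 k)
    (fun k n => wterm n (peel d) z x k) (N%:R * (M * q) * `|x|).
  move=> k n; apply: le_trans (pb n); rewrite l2pow_norm; exact: coord_le_l2norm.
congr seqsum; apply/funext => n /=; apply: eq_bigr => k _.
by rewrite wterm_peel.
Qed.

End Step.

(** The value at [j] is the space with index [j + 1], since [chainT] puts [Y] in front; hence index
    0 already holds a power. *)
Fixpoint l2chain (Y : completeNormedModType C) (j : nat) : completeNormedModType C :=
  if j is j'.+1 then l2pow N (l2chain Y j') else l2pow N Y.

(** Both branches are coordinate projections; the case distinction lets [chainT] compute. *)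
Definition l2chain_coord (Y : completeNormedModType C) (j : nat) :
    'I_N -> chainT Y (l2chain Y) j.+1 -> chainT Y (l2chain Y) j :=
  match j with
  | 0 => fun k (y : l2pow N Y) => y k
  | j'.+1 => fun k (y : l2pow N (l2chain Y j')) => y k
  end.

Lemma l2chain_separable_hilbert (Y : completeNormedModType C) j :
  separable_hilbert Y -> separable_hilbert (l2chain Y j).
Proof.
by move=> hY; elim: j => [|j IH]; exact: l2pow_separable_hilbert.
Qed.

Lemma l2chain_coord_bounded_op (Y : completeNormedModType C) j k :
  bounded_op (@l2chain_coord Y j k).
Proof. by case: j => [|j]; exact: coord_bounded_op. Qed.

(** Induction on the number [j] of peeled letters, with [m] the order of vanishing left over. Each
    new operator acts innermost, as in [chainprod]. *)
Lemma wseries_chain (A : normedModType C) (Y : completeNormedModType C)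
    (d : seq 'I_N -> A -> Y) (M q r : C) m j :
  0 <= q -> N%:R * (r * q) <= 4^-1 -> word_coefficients M q (m + j) d ->
  exists (M' : C) (d' : seq 'I_N -> A -> chainT Y (l2chain Y) j),
    word_coefficients M' q m d' /\
    forall z, `|z| < r -> forall x,
      wseries d z x = chainprod z (@l2chain_coord Y) j (wseries d' z x).
Proof.
move=> q0 qr; elim: j m => [|j IH] m dW.
  by exists M, d; rewrite addn0 in dW.
rewrite addnS -addSn in dW; have [M' [d' [dW' dE]]] := IH _ dW.
exists (N%:R * (M' * q)).
case: j {IH dW} d' dW' dE => [|j] d' dW' dE; exists (peel d'); split.
- exact: peel_word_coefficients.
- by move=> z zr x; rewrite dE// (wseries_peel x q0 qr dW' zr).
- exact: peel_word_coefficients.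
- by move=> z zr x; rewrite dE// (wseries_peel x q0 qr dW' zr).
Qed.

End Factorization.

(** * Choice of the radius and assembly of the factorization *)

Unset Implicit Arguments.

Theorem mainTheorem1 (R : realType) (N : nat)
  (U Y : completeNormedModType (Cx R))
  (hU : separable_hilbert U) (hY : separable_hilbert Y)
  (Gamma : set 'rV[(Cx R)]_N) (theta : 'rV[(Cx R)]_N -> U -> Y) (m : nat) :
  Gamma 0 -> holomorphic_on Gamma theta ->
  zero_multiplicity theta m -> (0 < m)%N ->
  exists (Ys : nat -> completeNormedModType (Cx R))
         (L : forall j : nat, 'I_N -> chainT Y Ys j.+1 -> chainT Y Ys j)
         (phi : 'rV[(Cx R)]_N -> U -> chainT Y Ys m)
         (V W : set 'rV[(Cx R)]_N),
    [/\ (forall j, (j < m)%N -> separable_hilbert (Ys j)),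
        (forall j k, (j < m)%N -> bounded_op (L j k)),
        V 0 /\ holomorphic_on V phi,
        (exists x : U, phi 0 x != 0) &
        [/\ open W, W 0, W `<=` Gamma, W `<=` V &
            (forall z, W z -> forall x : U, theta z x = chainprod z L m (phi z x))]].
Proof.
move=> G0 hth zth _.
have [d [M [q [s [q0 s0 dW thE]]]]] := word_expansion G0 hth zth.
(* This bound on [r] yields [N r q <= 1/4]; [N.+1] avoids dividing by 0 when [N = 0]. *)
have b0 : 0 < (4 * N.+1%:R * q)^-1 by rewrite invr_gt0 !mulr_gt0.
have [r r0 [rs rb]] := le_pair_gt0 s0 b0.
have qr : N%:R * (r * q) <= 4^-1.
  have : r * q <= (4 * N.+1%:R)^-1.
    by rewrite -ler_pdivlMr// -invfM.
  move=> /(ler_wpM2l (ler0n _ N))/le_trans; apply.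
  rewrite invfM mulrCA ler_piMr// ler_pdivrMr// mul1r ler_nat.
  exact: leqW.
(* With remaining order 0 the nonvanishing clause concerns a word of length 0, that is, the constant
   term. *)
have [M' [d' [[dop dM _ [t [x [st dt]]]] dE]]] :=
  wseries_chain (m := 0) (j := m) (ltW q0) qr dW.
exists (l2chain N Y), (@l2chain_coord R N Y), (wseries d').
exists [set z | `|z| < r], (Gamma `&` [set z | `|z| < r]); split.
- by move=> j _; exact: l2chain_separable_hilbert.
- by move=> j k _; exact: l2chain_coord_bounded_op.
- by split; [rewrite /= normr0|exact: (wseries_holomorphic (ltW q0) qr dop dM)].
(* At [z = 0] only the empty word contributes. *)
- exists x; rewrite /wseries seqsum_head => [|n]; last exact: wterm0.
  by rewrite (size0nil st) in dt.
- split.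
  + by apply: openI; [case: hth|exact: (@open_norm_lt _ 'rV[Cx R]_N)].
  + by split => //=; rewrite normr0.
  + by move=> z [].
  + by move=> z [].
  + move=> z [_ /= zr] y; rewrite -dE// thE//.
    exact: lt_le_trans zr rs.
Qed.
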